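(* Let $G_1$ and $G_2$ be two distinct graphs, which are neither complete nor null, and let $\bar{A}_1$ and $\bar{A}_2$ be, respectively, the adjacency matrices of the complement graphs $\bar{G}_1$ and $\bar{G}_2$. Then the two $J$-spherical representations of $G_1$ and $G_2$ have the same second distance (squared) if and only if $\lambda_1(\bar{A}_1)=\lambda_1(\bar{A}_2)$.
   Context: Graphs are simple and finite (the two graphs may have different numbers of nodes); the null graph is the graph with no edges. $\lambda_1(M)$ denotes the largest eigenvalue of a symmetric matrix $M$. A $J$-spherical representation of a graph $G$ on $n$ nodes in $\mathbb{R}^r$ is a configuration of points $p^1,\ldots,p^n\in\mathbb{R}^r$, lying on an $(r-1)$-sphere in $\mathbb{R}^r$ of radius $1$, for which there is a scalar $\beta>2$ such that for all $i\neq j$, $\|p^i-p^j\|^2=2$ if $\{i,j\}$ is an edge of $G$, and $\|p^i-p^j\|^2=\beta$ otherwise. Throughout, the points are assumed to lie in $\mathbb{R}^r$ with $r$ equal to the dimension of their affine span (so they affinely span $\mathbb{R}^r$). Every graph that is neither complete nor null admits a $J$-spherical representation in this sense, unique up to isometry; the scalar $\beta$ of this representation is called its second distance (squared). *)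

(* Defs.v *)
From HB Require Import structures.
From mathcomp Require Import all_boot all_order all_algebra.
From mathcomp Require Import all_classical all_reals.

Set Implicit Arguments.
Unset Strict Implicit.
Unset Printing Implicit Defensive.

Import Order.TTheory GRing.Theory Num.Theory.

Local Open Scope classical_set_scope.
Local Open Scope ring_scope.

Record sgraph := SGraph {
  num_nodes : nat;
  edge : rel 'I_num_nodes;
  edge_sym : symmetric edge;
  edge_irrefl : irreflexive edge
}.

Definition complete_graph (G : sgraph) : Prop :=
  forall i j : 'I_(num_nodes G), i != j -> edge i j.

Definition null_graph (G : sgraph) : Prop :=
  forall i j : 'I_(num_nodes G), ~~ edge i j.

Definition compl_edge (G : sgraph) : rel 'I_(num_nodes G) :=
  fun i j => (i != j) && ~~ edge i j.

Lemma compl_edge_sym (G : sgraph) : symmetric (@compl_edge G).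
Proof. by move=> i j; rewrite /compl_edge eq_sym edge_sym. Qed.

Lemma compl_edge_irrefl (G : sgraph) : irreflexive (@compl_edge G).
Proof. by move=> i; rewrite /compl_edge eqxx. Qed.

Definition complement (G : sgraph) : sgraph :=
  SGraph (@compl_edge_sym G) (@compl_edge_irrefl G).

Definition adjacency_mx (R : realType) (G : sgraph) : 'M[R]_(num_nodes G) :=
  \matrix_(i, j) (edge i j)%:R.

(* The spectrum of a square matrix is finite, and it is nonempty for a real
   symmetric matrix of positive size: for those the supremum is attained and
   is the largest eigenvalue. *)
Definition lambda1 (R : realType) (n : nat) (M : 'M[R]_n) : R :=
  sup [set a : R | eigenvalue M a].

(* The norm that MathComp-Analysis puts on 'rV[R]_r is the sup norm, so the
   squared Euclidean distance is written out. *)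
Definition sqdist (R : realType) (r : nat) (x y : 'rV[R]_r) : R :=
  \sum_(k < r) (x 0 k - y 0 k) ^+ 2.

Definition affinely_spans (R : realType) (n r : nat)
    (p : 'I_n -> 'rV[R]_r) : Prop :=
  forall x : 'rV[R]_r, exists2 w : 'I_n -> R,
    \sum_(i < n) w i = 1 & x = \sum_(i < n) w i *: p i.

(* The sphere may have any centre. If G is not complete, the points p
   determine the second distance beta. *)
Definition J_spherical (R : realType) (G : sgraph) (r : nat)
    (p : 'I_(num_nodes G) -> 'rV[R]_r) (beta : R) : Prop :=
  [/\ affinely_spans p,
      exists c : 'rV[R]_r, forall i, sqdist (p i) c = 1,
      2 < beta &
      forall i j, i != j ->
        sqdist (p i) (p j) = if edge i j then 2 else beta].

(* Main.v *)
Require Import Defs.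
From mathcomp Require Import all_boot all_order all_algebra.
From mathcomp Require Import all_classical all_reals.
From mathcomp Require Import ring.

(** The second distance of a $J$-spherical representation is determined by
    the complement graph through the formula
    [lambda1 Abar = 2 / (beta - 2)], and the right-hand side is an injective
    function of [beta]; the theorem is the comparison of two instances.

    To obtain the formula, translate the centre of the unit sphere to the
    origin and let [X] be the matrix whose rows are the translated points.
    Two unit vectors at squared distance [d] have inner product [1 - d / 2],
    which is [0] on the edges of the graph and [1 - beta / 2] on the non-edges.
    Hence the Gram matrix is [X *m X^T = 1 - s *: Abar] with
    [s = beta / 2 - 1 > 0] ([gram_J_spherical]).  It is positive semidefinite,
    so every eigenvalue of [Abar] is at most [1 / s].  It is also singular:
    the centre is an affine combination of the points, since these affinely
    span the space, and its weights form a nonzero vector that annihilates [X].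
    So [1 / s] is an eigenvalue of [Abar], hence the largest one
    ([lambda1_of_gram]). *)

Import Order.TTheory GRing.Theory Num.Theory.

Local Open Scope classical_set_scope.
Local Open Scope ring_scope.

Lemma row_mul_tr_ge0 (R : realType) (n : nat) (v : 'rV[R]_n) :
  0 <= (v *m v^T) 0 0.
Proof.
by rewrite mxE sumr_ge0 // => k _; rewrite mxE -expr2 sqr_ge0.
Qed.

Lemma row_mul_tr_gt0 (R : realType) (n : nat) (v : 'rV[R]_n) :
  v != 0 -> 0 < (v *m v^T) 0 0.
Proof.
move=> v0; rewrite lt_neqAle row_mul_tr_ge0 andbT eq_sym.
apply: contra v0 => /eqP vv0; apply/eqP/rowP => k; rewrite mxE.
move: vv0; rewrite mxE => /psumr_eq0P vv0.
have /eqP : v 0 k * v^T k 0 = 0.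
  by apply: vv0 => // i _; rewrite mxE -expr2 sqr_ge0.
by rewrite mxE mulf_eq0 orbb => /eqP.
Qed.

(** Evaluating the positive semidefinite form [X *m X^T] at an eigenvector of
    [M] with eigenvalue [a] gives a positive multiple of [1 - s * a], whence
    [a <= 1 / s]; a nonzero vector in the left kernel of [X] is an eigenvector
    that attains this bound. *)
Lemma lambda1_of_gram (R : realType) (n r : nat) (M : 'M[R]_n)
    (X : 'M[R]_(n, r)) (s : R) (w : 'rV[R]_n) :
  0 < s -> X *m X^T = 1%:M - s *: M -> w != 0 -> w *m X = 0 ->
  lambda1 M = s^-1.
Proof.
move=> s0 gramX w0 wX.
have eigs : [set a : R | eigenvalue M a] s^-1.
  apply/eigenvalueP; exists w => //.
  apply: (scalerI (lt0r_neq0 s0)); rewrite scalerA divff ?lt0r_neq0 // scale1r.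
  have : w *m (X *m X^T) = 0 by rewrite mulmxA wX mul0mx.
  by rewrite gramX mulmxBr mulmx1 -scalemxAr => /eqP; rewrite subr_eq0 => /eqP.
have ubs : ubound [set a : R | eigenvalue M a] s^-1.
  move=> a /eigenvalueP[v vM v0].
  have : 0 <= ((v *m X) *m (v *m X)^T) 0 0 by exact: row_mul_tr_ge0.
  rewrite trmx_mul mulmxA -(mulmxA v) gramX mulmxBr mulmx1 -scalemxAr vM.
  rewrite scalerA -{1}(scale1r v) -scalerBl -scalemxAl mxE.
  rewrite (pmulr_lge0 _ (row_mul_tr_gt0 _ _ _ v0)) subr_ge0 => sa1.
  by rewrite -(ler_pM2l s0) divff ?lt0r_neq0.
apply/le_anti/andP; split; first by apply: ge_sup => //; exists s^-1.
by apply: ub_le_sup => //; exists s^-1.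
Qed.

(** Entrywise, this is polarization:
    [|x - y|^2 = |x|^2 + |y|^2 - 2 <x, y>] for the points seen from [c]. *)
Lemma gram_J_spherical (R : realType) (G : sgraph) (r : nat)
    (p : 'I_(num_nodes G) -> 'rV[R]_r) (beta : R) (c : 'rV[R]_r) :
  (forall i, sqdist (p i) c = 1) ->
  (forall i j, i != j -> sqdist (p i) (p j) = if edge i j then 2 else beta) ->
  let X := \matrix_i (p i - c) in
  X *m X^T = 1%:M - ((beta - 2) / 2) *: adjacency_mx R (complement G).
Proof.
move=> pc1 pp X.
have polar i j : (X *m X^T) i j
    = (sqdist (p i) c + sqdist (p j) c - sqdist (p i) (p j)) / 2.
  rewrite mxE /sqdist -big_split -sumrB mulr_suml; apply: eq_bigr => k _ /=.
  by rewrite !mxE; field.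
apply/matrixP => i j; rewrite polar !pc1 !mxE /= /compl_edge.
have [<-|ij] := eqVneq i j.
  rewrite (_ : sqdist _ _ = 0); first by rewrite /=; field.
  by rewrite /sqdist big1 // => k _; rewrite subrr expr0n.
by rewrite pp //; case: (edge i j) => /=; field.
Qed.

Lemma lambda1_J_spherical (R : realType) (G : sgraph) (r : nat)
    (p : 'I_(num_nodes G) -> 'rV[R]_r) (beta : R) :
  J_spherical p beta ->
  lambda1 (adjacency_mx R (complement G)) = ((beta - 2) / 2)^-1.
Proof.
case=> spanp [c pc1] beta2 pp.
have [w w1 cw] := spanp c.
apply: (@lambda1_of_gram _ _ _ _ _ _ (\row_i w i) _
  (gram_J_spherical _ _ _ _ _ _ pc1 pp)).
- by rewrite divr_gt0 ?ltr0n // subr_gt0.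
(* The weights sum to 1, so they are not all zero, and they represent the
   centre [c] itself, so they annihilate the vectors [p i - c]. *)
- apply/eqP => /rowP w0; move/eqP: w1; rewrite big1 => [|i _].
    by rewrite eq_sym oner_eq0.
  by have := w0 i; rewrite !mxE.
- rewrite mulmx_sum_row.
  under eq_bigr => i _ do rewrite rowK mxE scalerBr.
  by rewrite sumrB -cw -scaler_suml w1 scale1r subrr.
Qed.

Theorem theorem6p2 (R : realType) (G1 G2 : sgraph)
    (hG : G1 <> G2)
    (hc1 : ~ complete_graph G1) (hn1 : ~ null_graph G1)
    (hc2 : ~ complete_graph G2) (hn2 : ~ null_graph G2)
    (r1 r2 : nat)
    (p1 : 'I_(num_nodes G1) -> 'rV[R]_r1) (p2 : 'I_(num_nodes G2) -> 'rV[R]_r2)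
    (beta1 beta2 : R)
    (hp1 : J_spherical p1 beta1) (hp2 : J_spherical p2 beta2) :
  beta1 = beta2 <->
  lambda1 (adjacency_mx R (complement G1)) =
  lambda1 (adjacency_mx R (complement G2)).
Proof.
rewrite (lambda1_J_spherical _ _ _ _ _ hp1) (lambda1_J_spherical _ _ _ _ _ hp2).
split=> [-> //|/invr_inj half_eq].
have two0 : (2^-1 : R) != 0 by rewrite invr_eq0 pnatr_eq0.
by have /addIr := mulIf two0 half_eq.
Qed.
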